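(* Let $n$ be a positive integer, let $a_0>0$ be real, and let $p\in\mathcal{H}[a_0,n]$. Suppose that there exists a point $z_0\in\mathbb{U}$ such that $\mathrm{Re}(p(z))>0$ for all $z$ with $|z|<|z_0|$, and $p(z_0)=\beta i$ for some real $\beta\neq 0$. Then $$\frac{z_0p'(z_0)}{p(z_0)}=il$$ for a real number $l$ such that $$l\geq \frac{n}{2}\left(\frac{a_0}{\beta}+\frac{\beta}{a_0}\right)\geq n\quad\text{if }\beta>0,$$ and $$l\leq \frac{n}{2}\left(\frac{a_0}{\beta}+\frac{\beta}{a_0}\right)\leq -n\quad\text{if }\beta<0.$$
   Context: $\mathbb{U}=\{z\in\mathbb{C}:|z|<1\}$ is the open unit disk. For $a_0\in\mathbb{C}$ and a positive integer $n$, $\mathcal{H}[a_0,n]$ is the class of functions $p$ analytic in $\mathbb{U}$ of the form $p(z)=a_0+\sum_{k=n}^{\infty}a_kz^k$. *)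

(* Defs.v *)
From Stdlib Require Import Reals.
From Coquelicot Require Import Coquelicot.

Open Scope R_scope.

Definition unit_disk (z : C) : Prop := Cmod z < 1.

Definition analytic_on (D : C -> Prop) (f : C -> C) : Prop :=
  forall z : C, D z -> @ex_derive C_AbsRing C_NormedModule f z.

(** The class [H[a0, n]]: functions analytic in the unit disk of the form
    [a0 + sum_(k >= n) a_k z^k].  The coefficients of index [0 < k < n] are
    forced to vanish, so [is_pseries] (which sums from 0) gives that series. *)
Definition class_H (a0 : C) (n : nat) (p : C -> C) : Prop :=
  analytic_on unit_disk p /\
  exists a : nat -> C,
    a O = a0 /\
    (forall k : nat, (0 < k < n)%nat -> a k = RtoC 0) /\
    (forall z : C, unit_disk z -> @is_pseries C_AbsRing C_NormedModule a z (p z)).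

(* Main.v *)
(** Put [w = (p - a0) / (p + a0)] and [r = |z0|].  On each closed disk of radius
    [rho < r] the function [w] is a uniform limit of polynomials divisible by [z^n]:
    [p] is approximated by its partial sums, and [1 / (p + a0)] by a geometric series
    in [p].  Hence the maximum modulus principle is only needed for polynomials, where
    interpolation at roots of unity gives [|f| <= N * max |f|] for degree less than
    [N], and passing to powers of [f] removes the factor [N].  This yields the Schwarz
    bound [|w(z)| <= (|z| / r)^n].

    Let [D = z0 p'(z0)].  Differentiating [Re p > 0] at [z0] in all inward directions
    gives [Im D = 0]; differentiating the Schwarz bound along the radius gives
    [2 a0 Re D <= - n (a0^2 + beta^2)].  The conclusion follows from
    [D / (i beta) = - i D / beta]. *)

Require Import Defs.
From Stdlib Require Import Reals Lra Lia.
From Coquelicot Require Import Coquelicot.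
Open Scope R_scope.

(** * Finite sums of complex numbers *)

Fixpoint Csum (f : nat -> C) (n : nat) : C :=
  match n with
  | O => RtoC 0
  | S m => (Csum f m + f m)%C
  end.

Lemma Csum_ext (f g : nat -> C) (n : nat) :
  (forall j, (j < n)%nat -> f j = g j) -> Csum f n = Csum g n.
Proof.
  induction n as [|n IH]; intros H; simpl; [reflexivity|].
  rewrite IH, H by (try intros; try apply H; lia). reflexivity.
Qed.

Lemma Csum_plus (f g : nat -> C) (n : nat) :
  Csum (fun j => (f j + g j)%C) n = (Csum f n + Csum g n)%C.
Proof. induction n as [|n IH]; simpl; [|rewrite IH]; ring. Qed.

Lemma Csum_mult_l (c : C) (f : nat -> C) (n : nat) :
  Csum (fun j => (c * f j)%C) n = (c * Csum f n)%C.
Proof. induction n as [|n IH]; simpl; [|rewrite IH]; ring. Qed.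

Lemma Csum_swap (f : nat -> nat -> C) (n m : nat) :
  Csum (fun i => Csum (f i) m) n = Csum (fun j => Csum (fun i => f i j) n) m.
Proof.
  induction n as [|n IH]; simpl.
  - induction m as [|m IHm]; simpl; [reflexivity|]. rewrite <- IHm; ring.
  - rewrite IH, Csum_plus. reflexivity.
Qed.

Lemma Csum_zero (f : nat -> C) (n : nat) :
  (forall j, (j < n)%nat -> f j = RtoC 0) -> Csum f n = RtoC 0.
Proof.
  induction n as [|n IH]; intros H; simpl; [reflexivity|].
  rewrite IH, H by (try intros; try apply H; lia). ring.
Qed.

Lemma Csum_single (f : nat -> C) (n k : nat) :
  (k < n)%nat -> (forall j, (j < n)%nat -> j <> k -> f j = RtoC 0) -> Csum f n = f k.
Proof.
  induction n as [|n IH]; intros Hk H; [lia|]. simpl.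
  destruct (Nat.eq_dec k n) as [->|Hne].
  - rewrite Csum_zero by (intros; apply H; lia). ring.
  - rewrite IH, (H n) by (try intros; try apply H; lia). ring.
Qed.

Lemma Cmod_Csum_le (f : nat -> C) (n : nat) (M : R) :
  (forall j, (j < n)%nat -> Cmod (f j) <= M) -> Cmod (Csum f n) <= INR n * M.
Proof.
  induction n as [|n IH]; intros H.
  - simpl. rewrite Cmod_0. lra.
  - rewrite S_INR; simpl Csum.
    apply Rle_trans with (1 := Cmod_triangle _ _).
    assert (Cmod (Csum f n) <= INR n * M) by (apply IH; intros; apply H; lia).
    assert (Cmod (f n) <= M) by (apply H; lia). lra.
Qed.

Lemma Csum_geom (x : C) (n : nat) :
  ((x - 1) * Csum (fun j => x ^ j) n = x ^ n - 1)%C.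
Proof. induction n as [|n IH]; simpl; [|rewrite Cmult_plus_distr_l, IH]; ring. Qed.

(** * Roots of unity and their orthogonality *)

Definition unity_root (N : nat) : C := (cos (2 * PI / INR N), sin (2 * PI / INR N)).

Lemma Cpow_cos_sin (t : R) (k : nat) :
  ((cos t, sin t) ^ k)%C = (cos (INR k * t), sin (INR k * t)).
Proof.
  induction k as [|k IH].
  - simpl. rewrite Rmult_0_l, cos_0, sin_0. reflexivity.
  - rewrite Cpow_S, IH, S_INR.
    replace ((INR k + 1) * t) with (t + INR k * t) by ring.
    rewrite cos_plus, sin_plus. unfold Cmult; simpl. f_equal; ring.
Qed.

Lemma Cmod_cos_sin (t : R) : Cmod (cos t, sin t) = 1.
Proof.
  unfold Cmod; simpl fst; simpl snd.
  replace (cos t ^ 2 + sin t ^ 2) with 1 by (generalize (sin2_cos2 t); unfold Rsqr; lra).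
  apply sqrt_1.
Qed.

Lemma unity_root_pow_N (N : nat) : (0 < N)%nat -> (unity_root N ^ N)%C = RtoC 1.
Proof.
  intros HN. unfold unity_root. rewrite Cpow_cos_sin.
  replace (INR N * (2 * PI / INR N)) with (2 * PI)
    by (field; apply not_0_INR; lia).
  rewrite cos_2PI, sin_2PI. reflexivity.
Qed.

Lemma unity_root_pow_neq_1 (N k : nat) :
  (0 < k < N)%nat -> (unity_root N ^ k)%C <> RtoC 1.
Proof.
  intros Hk E. unfold unity_root in E. rewrite Cpow_cos_sin in E.
  injection E as Ec Es.
  assert (HN : 0 < INR N) by (apply lt_0_INR; lia).
  assert (Hk0 : 0 < INR k) by (apply lt_0_INR; lia).
  assert (HkN : INR k < INR N) by (apply lt_INR; lia).
  (* Halving the angle puts [u] strictly between 0 and [PI], so [cos (2 * u) = 1] would contradict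
     [sin u > 0]. *)
  set (u := PI * (INR k / INR N)).
  replace (INR k * (2 * PI / INR N)) with (2 * u) in Ec by (unfold u; field; lra).
  rewrite cos_2a_sin in Ec.
  assert (0 < INR k / INR N) by (apply Rdiv_lt_0_compat; lra).
  assert (INR k / INR N < 1) by (apply Rlt_div_l; lra).
  assert (0 < sin u).
  { assert (HP := PI_RGT_0). apply sin_gt_0; unfold u; nra. }
  nra.
Qed.

Lemma unity_root_neq_0 (N : nat) : unity_root N <> RtoC 0.
Proof.
  intros E. assert (H := Cmod_cos_sin (2 * PI / INR N)).
  fold (unity_root N) in H. rewrite E, Cmod_0 in H. lra.
Qed.

Lemma unity_root_pow_inj (N k l : nat) :
  (k < N)%nat -> (l < N)%nat ->
  (unity_root N ^ k)%C = (unity_root N ^ l)%C -> k = l.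
Proof.
  assert (key : forall k l, (k < l < N)%nat ->
            (unity_root N ^ k)%C <> (unity_root N ^ l)%C).
  { clear. intros k l H E. apply (unity_root_pow_neq_1 N (l - k)); [lia|].
    replace l with (k + (l - k))%nat in E at 1 by lia.
    rewrite Cpow_add_r in E.
    assert (H0 := Cpow_nz _ k (unity_root_neq_0 N)).
    replace (unity_root N ^ (l - k))%C
      with (/ (unity_root N ^ k) * (unity_root N ^ k * unity_root N ^ (l - k)))%C
      by (field; assumption).
    rewrite <- E. field; assumption. }
  intros Hk Hl E. destruct (Nat.lt_trichotomy k l) as [H|[H|H]]; [|exact H|].
  - elim (key k l); auto; lia.
  - elim (key l k); auto; lia.
Qed.

(** The summand is the [j]-th power of [x = w ^ k * (/ w) ^ l]. Injectivity of the powers gives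
    [x <> 1], while [x ^ N = 1], so the geometric sum vanishes. *)
Lemma unity_root_orthogonality (N k l : nat) :
  (k < N)%nat -> (l < N)%nat -> k <> l ->
  Csum (fun j => ((unity_root N ^ j) ^ k * ((/ unity_root N) ^ j) ^ l)%C) N = RtoC 0.
Proof.
  intros Hk Hl Hkl. assert (H0 := unity_root_neq_0 N).
  set (w := unity_root N) in *.
  set (x := (w ^ k * (/ w) ^ l)%C).
  assert (Hx : x <> RtoC 1).
  { intros E. apply Hkl, (unity_root_pow_inj N); auto. fold w.
    transitivity (x * w ^ l)%C.
    - unfold x. rewrite Cpow_inv by auto. field. now apply Cpow_nz.
    - rewrite E; ring. }
  assert (HxN : (x ^ N = 1)%C).
  { unfold x. rewrite Cpow_mult_l, <- !Cpow_mult_r, (Nat.mul_comm k), (Nat.mul_comm l),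
      !Cpow_mult_r, Cpow_inv by auto.
    unfold w. rewrite unity_root_pow_N by lia.
    replace (/ 1)%C with (RtoC 1) by field. rewrite !Cpow_1_l. ring. }
  rewrite Csum_ext with (g := fun j => (x ^ j)%C).
  2:{ intros j _. unfold x. rewrite Cpow_mult_l, <- !Cpow_mult_r.
      f_equal; f_equal; lia. }
  assert (G := Csum_geom x N). rewrite HxN in G.
  assert (Hx1 := Cminus_eq_contra _ _ Hx).
  replace (Csum (fun j => (x ^ j)%C) N)
    with (/ (x - 1) * ((x - 1) * Csum (fun j => (x ^ j)%C) N))%C by (field; auto).
  rewrite G. field; auto.
Qed.

(** * Polynomials and the maximum modulus principle for them *)

(** Polynomials of degree less than [N], kept as functions without coefficient lists. Closure under
    pointwise equality stands in for functional extensionality. *)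
Inductive poly_lt (N : nat) : (C -> C) -> Prop :=
  | poly_mono (c : C) (k : nat) : (k < N)%nat -> poly_lt N (fun z => (c * z ^ k)%C)
  | poly_plus (f g : C -> C) :
      poly_lt N f -> poly_lt N g -> poly_lt N (fun z => (f z + g z)%C)
  | poly_ext (f g : C -> C) : (forall z, f z = g z) -> poly_lt N f -> poly_lt N g.

Lemma poly_lt_weaken (N M : nat) (f : C -> C) :
  (N <= M)%nat -> poly_lt N f -> poly_lt M f.
Proof.
  intros H; induction 1.
  - apply poly_mono; lia.
  - now apply poly_plus.
  - now apply poly_ext with f.
Qed.

Lemma poly_lt_mult (N M : nat) (f g : C -> C) :
  poly_lt N f -> poly_lt M g -> poly_lt (N + M) (fun z => (f z * g z)%C).
Proof.
  intros Hf Hg; revert Hf; induction 1 as [c k Hk|f1 f2 _ IH1 _ IH2|f1 f2 E _ IH].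
  - induction Hg as [d l Hl|g1 g2 _ IH1 _ IH2|g1 g2 E _ IH].
    + apply poly_ext with (fun z => ((c * d) * z ^ (k + l))%C).
      * intros z; rewrite Cpow_add_r; ring.
      * apply poly_mono; lia.
    + eapply poly_ext; [|exact (poly_plus _ _ _ IH1 IH2)]. intros z; simpl; ring.
    + eapply poly_ext; [|exact IH]. intros z; simpl; now rewrite E.
  - eapply poly_ext; [|exact (poly_plus _ _ _ IH1 IH2)]. intros z; simpl; ring.
  - eapply poly_ext; [|exact IH]. intros z; simpl; now rewrite E.
Qed.

(** The degree bound is linear in [m], which is slow enough for the passage to [m]-th roots. The
    [+ 1] accommodates the constant 1 at [m = 0]. *)
Lemma poly_lt_pow (N : nat) (f : C -> C) (m : nat) :
  poly_lt N f -> poly_lt (N * m + 1) (fun z => (f z ^ m)%C).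
Proof.
  intros Hf; induction m as [|m IH].
  - apply poly_ext with (fun z => (1 * z ^ 0)%C); [intros; simpl; ring|].
    apply poly_mono; lia.
  - apply poly_lt_weaken with (N + (N * m + 1))%nat; [lia|].
    exact (poly_lt_mult _ _ _ _ Hf IH).
Qed.

(** A discrete Cauchy formula on the circle of radius [rho], the inner sum being the kernel. It is
    linear in [f]; for a monomial of degree [k], exchanging the sums and using orthogonality leaves
    only [l = k]. *)
Lemma poly_lt_interpolation (N : nat) (rho : R) (f : C -> C) :
  0 < rho -> poly_lt N f -> forall z : C,
  (INR N * f z =
   Csum (fun j => f (rho * unity_root N ^ j)
                  * Csum (fun l => (z / rho) ^ l * ((/ unity_root N) ^ j) ^ l) N) N)%C.
Proof.
  intros Hr Hf z. induction Hf as [c k Hk|f g _ IHf _ IHg|f g E _ IH].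
  - set (w := unity_root N). assert (Hw : w <> RtoC 0) by apply unity_root_neq_0.
    rewrite Csum_ext with (g := fun j =>
      Csum (fun l => (c * rho ^ k * (z / rho) ^ l * ((w ^ j) ^ k * ((/ w) ^ j) ^ l))%C) N).
    2:{ intros j _. rewrite <- Csum_mult_l. apply Csum_ext. intros l _.
        rewrite Cpow_mult_l. ring. }
    rewrite Csum_swap.
    rewrite Csum_single with (k := k); [|assumption|].
    + rewrite Csum_mult_l.
      rewrite Csum_ext with (g := fun _ => RtoC 1).
      2:{ intros j _. rewrite <- Cpow_mult_l, <- Cpow_mult_l, Cinv_r, !Cpow_1_l; auto. }
      replace (Csum (fun _ => RtoC 1) N) with (RtoC (INR N)).
      2:{ clear. induction N as [|N IH]; [reflexivity|].
          rewrite S_INR, RtoC_plus, IH. reflexivity. }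
      assert (Hrc : RtoC rho <> RtoC 0) by (intros E; injection E; lra).
      unfold Cdiv. rewrite Cpow_mult_l, Cpow_inv by exact Hrc.
      field. now apply Cpow_nz.
    + intros l Hl Hlk. rewrite Csum_mult_l. unfold w.
      rewrite unity_root_orthogonality by auto. ring.
  - rewrite Cmult_plus_distr_l, IHf, IHg, <- Csum_plus.
    apply Csum_ext; intros; ring.
  - rewrite <- E, IH. apply Csum_ext; intros. now rewrite E.
Qed.

Lemma poly_lt_bound_circle (N : nat) (rho M : R) (f : C -> C) :
  0 < rho -> poly_lt N f -> (forall z, Cmod z = rho -> Cmod (f z) <= M) ->
  forall z, Cmod z <= rho -> Cmod (f z) <= INR N * M.
Proof.
  intros Hr Hf HM z Hz.
  assert (HM0 : 0 <= M).
  { apply Rle_trans with (2 := HM (RtoC rho) ltac:(rewrite Cmod_R; apply Rabs_right; lra)).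
    apply Cmod_ge_0. }
  assert (Hrc : RtoC rho <> RtoC 0) by (intros E; injection E; lra).
  assert (HN : 0 < INR N).
  { apply lt_0_INR. clear HM. induction Hf; auto; lia. }
  assert (Hw : Cmod (unity_root N) = 1) by apply Cmod_cos_sin.
  apply Rmult_le_reg_l with (INR N); [assumption|].
  replace (INR N * Cmod (f z)) with (Cmod (INR N * f z)).
  2:{ rewrite Cmod_mult, Cmod_R, Rabs_right; lra. }
  rewrite (poly_lt_interpolation N rho f Hr Hf z).
  (* The kernel has [N] terms of modulus at most 1, so each of the [N] outer terms is at most
     [M * INR N]; one factor [INR N] has been cancelled above. *)
  apply Cmod_Csum_le. intros j _. rewrite Cmod_mult, Rmult_comm.
  apply Rmult_le_compat; try apply Cmod_ge_0.
  - rewrite <- (Rmult_1_r (INR N)). apply Cmod_Csum_le. intros l _.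
    rewrite Cmod_mult, !Cmod_pow, Cmod_inv by apply unity_root_neq_0.
    rewrite Hw, Rinv_1, !pow1, Rmult_1_r.
    rewrite <- (pow1 l). apply pow_incr. split; [apply Cmod_ge_0|].
    rewrite Cmod_div, Cmod_R, Rabs_right by (auto; lra).
    apply Rle_div_l; lra.
  - apply HM. rewrite Cmod_mult, Cmod_pow, Hw, pow1, Cmod_R, Rabs_right; lra.
Qed.

(** If [x = (1 + h) * M] with [h > 0], Bernoulli's inequality at the even exponent [2 * m] makes the
    left side at least [(1 + m * h) ^ 2] times [M ^ (2 * m)]. This is quadratic in [m] and overtakes
    the linear factor once [m > 2 * A / h ^ 2]. *)
Lemma le_of_pow_le_linear (x M A : R) :
  0 <= x -> 0 <= M -> 0 <= A ->
  (forall m : nat, x ^ m <= (A * INR m + 1) * M ^ m) -> x <= M.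
Proof.
  intros Hx HM HA H. destruct (Rle_lt_dec x M) as [|Hlt]; [assumption|exfalso].
  destruct (Req_dec M 0) as [->|HM0].
  { specialize (H 1%nat). simpl in H. lra. }
  set (h := x / M - 1).
  assert (Hh : 0 < h).
  { unfold h. assert (1 < x / M) by (apply Rlt_div_r; lra). lra. }
  assert (Hm : forall m : nat, (1 + INR m * h) * (1 + INR m * h) <= A * (2 * INR m) + 1).
  { intros m. specialize (H (m + m)%nat).
    rewrite plus_INR in H. rewrite !pow_add in H.
    assert (HMm : 0 < M ^ m) by (apply pow_lt; lra).
    assert (B : 1 + INR m * h <= (x / M) ^ m).
    { replace (x / M) with (1 + h) by (unfold h; ring). apply poly; lra. }
    assert (Hxm : x ^ m = (x / M) ^ m * M ^ m).
    { rewrite <- Rpow_mult_distr. f_equal. field. lra. }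
    rewrite Hxm in H. set (y := (x / M) ^ m) in *.
    assert (y * y <= A * (2 * INR m) + 1).
    { apply Rmult_le_reg_r with (M ^ m * M ^ m); [nra|].
      replace (A * (2 * INR m) + 1) with (A * (INR m + INR m) + 1) by ring. lra. }
    assert (0 <= INR m * h) by (apply Rmult_le_pos; [apply pos_INR|lra]).
    nra. }
  destruct (INR_unbounded (2 * A / (h * h))) as [m Hb].
  specialize (Hm m).
  assert (Hhh : 0 < h * h) by nra.
  assert (2 * A < INR m * (h * h)).
  { apply Rlt_div_l in Hb; lra. }
  assert (0 < INR m).
  { destruct m; [simpl in *; nra|apply lt_0_INR; lia]. }
  nra.
Qed.

(* Applying the crude bound to the powers [f^m] and taking [m]-th roots removes
   the factor [N]. *)
Lemma poly_max_modulus (N : nat) (rho M : R) (f : C -> C) :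
  0 < rho -> poly_lt N f -> (forall z, Cmod z = rho -> Cmod (f z) <= M) ->
  forall z, Cmod z <= rho -> Cmod (f z) <= M.
Proof.
  intros Hr Hf HM z Hz.
  assert (HM0 : 0 <= M).
  { apply Rle_trans with (2 := HM (RtoC rho) ltac:(rewrite Cmod_R; apply Rabs_right; lra)).
    apply Cmod_ge_0. }
  apply le_of_pow_le_linear with (A := INR N); auto using Cmod_ge_0, pos_INR.
  intros m. rewrite <- Cmod_pow.
  replace (INR N * INR m + 1) with (INR (N * m + 1)) by (rewrite plus_INR, mult_INR; reflexivity).
  apply (poly_lt_bound_circle _ rho (M ^ m) (fun z => (f z ^ m)%C)); auto.
  - now apply poly_lt_pow.
  - intros y Hy. rewrite Cmod_pow. apply pow_incr. split; [apply Cmod_ge_0|auto].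
Qed.

(** * Uniform approximation by polynomials divisible by a power of [z] *)

(** This plays the role of analyticity with a zero of order at least [n] at 0. The factor [z ^ n]
    sits in the approximants, so the quotient of [f] by [z ^ n] never has to be formed. *)
Definition approx (rho : R) (n : nat) (f : C -> C) : Prop :=
  forall eps : R, 0 < eps -> exists N g, poly_lt N g /\
    forall z, Cmod z <= rho -> Cmod (f z - z ^ n * g z) <= eps.

Lemma Cmod_le_sub (x y : C) : Cmod x <= Cmod y + Cmod (x - y).
Proof. replace x with (y + (x - y))%C at 1 by ring. apply Cmod_triangle. Qed.

Lemma Cmod_sub_sym (x y : C) : Cmod (x - y) = Cmod (y - x).
Proof. rewrite <- Cmod_opp. f_equal. ring. Qed.

Lemma le_of_le_mult_eps (x y k : R) :
  0 < k -> (forall eps, 0 < eps -> x <= y + k * eps) -> x <= y.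
Proof.
  intros Hk H. apply le_epsilon. intros e He.
  specialize (H (e / k) ltac:(apply Rdiv_lt_0_compat; lra)).
  replace (k * (e / k)) with e in H by (field; lra). exact H.
Qed.

Lemma Cmod_pow_le (z : C) (rho : R) (n : nat) :
  Cmod z <= rho -> 0 <= Cmod z ^ n <= rho ^ n.
Proof.
  intros H. split.
  - apply pow_le, Cmod_ge_0.
  - apply pow_incr. split; [apply Cmod_ge_0|exact H].
Qed.

(** The maximum modulus principle is applied to the polynomial cofactor [g], which is at most
    [(M + eps) / rho ^ n] on the circle; multiplying back by [z ^ n] gives the decay at 0. *)
Lemma approx_max_modulus (rho M : R) (n : nat) (f : C -> C) :
  0 < rho -> approx rho n f -> (forall z, Cmod z = rho -> Cmod (f z) <= M) ->
  forall z, Cmod z <= rho -> rho ^ n * Cmod (f z) <= Cmod z ^ n * M.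
Proof.
  intros Hr Hf HM z Hz.
  assert (Hrn : 0 < rho ^ n) by now apply pow_lt.
  assert (Hzn := Cmod_pow_le z rho n Hz).
  (* One [rho ^ n * eps] pays for replacing [f z] by [z ^ n * g z], the other for the [eps] in the
     bound on [g]. *)
  apply le_of_le_mult_eps with (2 * rho ^ n); [lra|]. intros eps He.
  destruct (Hf eps He) as (N & g & Hg & Hfg).
  assert (B : Cmod (g z) <= (M + eps) / rho ^ n).
  { apply (poly_max_modulus N rho) ; auto. intros y Hy.
    apply Rle_div_r; [lra|]. rewrite <- Hy, <- Cmod_pow, <- Cmod_mult, Cmult_comm.
    apply Rle_trans with (1 := Cmod_le_sub _ (f y)).
    rewrite Cmod_sub_sym. specialize (HM y Hy).
    assert (Hfy := Hfg y ltac:(lra)). lra. }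
  assert (E := Hfg z Hz).
  assert (T := Cmod_le_sub (f z) (z ^ n * g z)).
  rewrite Cmod_mult, Cmod_pow in T.
  apply Rle_div_r in B; [|lra].
  assert (rho ^ n * (Cmod z ^ n * Cmod (g z)) <= Cmod z ^ n * (M + eps)) by nra.
  nra.
Qed.

Lemma poly_lt_bounded (rho : R) (N : nat) (f : C -> C) :
  poly_lt N f -> exists M, forall z, Cmod z <= rho -> Cmod (f z) <= M.
Proof.
  induction 1 as [c k _|f g _ [A HA] _ [B HB]|f g E _ [A HA]].
  - exists (Cmod c * rho ^ k). intros z Hz. rewrite Cmod_mult, Cmod_pow.
    apply Rmult_le_compat_l; [apply Cmod_ge_0|]. now apply Cmod_pow_le.
  - exists (A + B). intros z Hz. apply Rle_trans with (1 := Cmod_triangle _ _).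
    specialize (HA z Hz). specialize (HB z Hz). lra.
  - exists A. intros z Hz. rewrite <- E. auto.
Qed.

Lemma approx_bounded (rho : R) (n : nat) (f : C -> C) :
  approx rho n f -> exists M, 0 < M /\ forall z, Cmod z <= rho -> Cmod (f z) <= M.
Proof.
  intros Hf. destruct (Hf 1 Rlt_0_1) as (N & g & Hg & Hfg).
  destruct (poly_lt_bounded rho N g Hg) as [B HB].
  (* The sign of [rho] is not assumed; for negative [rho] the disk is empty and [B] may be negative,
     hence the absolute value. *)
  exists (Rabs (rho ^ n * B) + 1). split.
  - assert (H := Rabs_pos (rho ^ n * B)). lra.
  - intros z Hz. apply Rle_trans with (1 := Cmod_le_sub _ (z ^ n * g z)).
    apply Rplus_le_compat; [|auto]. apply Rle_trans with (2 := Rle_abs _).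
    rewrite Cmod_mult, Cmod_pow. apply Rmult_le_compat; auto using Cmod_ge_0.
    + now apply (Cmod_pow_le z rho).
    + now apply Cmod_pow_le.
Qed.

Lemma approx_ext (rho : R) (n : nat) (f g : C -> C) :
  (forall z, Cmod z <= rho -> f z = g z) -> approx rho n f -> approx rho n g.
Proof.
  intros E Hf eps He. destruct (Hf eps He) as (N & h & Hh & H).
  exists N, h. split; auto. intros z Hz. rewrite <- E; auto.
Qed.

Lemma approx_const (rho : R) (c : C) : approx rho 0 (fun _ => c).
Proof.
  intros eps He. exists 1%nat, (fun z => (c * z ^ 0)%C). split.
  - apply poly_mono; lia.
  - intros z _. simpl. replace (c - 1 * (c * 1))%C with (RtoC 0) by ring.
    rewrite Cmod_0; lra.
Qed.

Lemma approx_plus (rho : R) (n : nat) (f g : C -> C) :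
  approx rho n f -> approx rho n g -> approx rho n (fun z => (f z + g z)%C).
Proof.
  intros Hf Hg eps He.
  destruct (Hf (eps / 2) ltac:(lra)) as (N & u & Hu & Hfu).
  destruct (Hg (eps / 2) ltac:(lra)) as (M & v & Hv & Hgv).
  exists (N + M)%nat, (fun z => (u z + v z)%C). split.
  - apply poly_plus; [apply poly_lt_weaken with N|apply poly_lt_weaken with M]; auto; lia.
  - intros z Hz. specialize (Hfu z Hz). specialize (Hgv z Hz).
    replace (f z + g z - z ^ n * (u z + v z))%C
      with ((f z - z ^ n * u z) + (g z - z ^ n * v z))%C by ring.
    apply Rle_trans with (1 := Cmod_triangle _ _). lra.
Qed.

Lemma approx_mult (rho : R) (n : nat) (f g : C -> C) :
  approx rho n f -> approx rho 0 g -> approx rho n (fun z => (f z * g z)%C).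
Proof.
  intros Hf Hg eps He.
  destruct (approx_bounded _ _ _ Hf) as (A & HA & HfA).
  destruct (approx_bounded _ _ _ Hg) as (B & HB & HgB).
  (* The error splits into [e1 * B] and [(A + e1) * e2], each equal to [eps / 2]; here [A + e1]
     bounds the approximant of [f]. *)
  set (e1 := eps / (2 * B)).
  assert (He1 : 0 < e1) by (apply Rdiv_lt_0_compat; lra).
  set (e2 := eps / (2 * (A + e1))).
  assert (He2 : 0 < e2) by (apply Rdiv_lt_0_compat; lra).
  destruct (Hf e1 He1) as (N & u & Hu & Hfu).
  destruct (Hg e2 He2) as (M & v & Hv & Hgv).
  exists (N + M)%nat, (fun z => (u z * v z)%C). split; [now apply poly_lt_mult|].
  intros z Hz. specialize (Hfu z Hz). specialize (Hgv z Hz).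
  specialize (HfA z Hz). specialize (HgB z Hz). simpl in Hgv.
  replace (1 * v z)%C with (v z) in Hgv by ring.
  replace (f z * g z - z ^ n * (u z * v z))%C
    with ((f z - z ^ n * u z) * g z + (z ^ n * u z) * (g z - v z))%C by ring.
  apply Rle_trans with (1 := Cmod_triangle _ _). rewrite (Cmod_mult (f z - _)).
  rewrite (Cmod_mult (z ^ n * u z)).
  assert (Hzu : Cmod (z ^ n * u z) <= A + e1).
  { apply Rle_trans with (1 := Cmod_le_sub _ (f z)). rewrite Cmod_sub_sym. lra. }
  replace eps with (e1 * B + (A + e1) * e2).
  2:{ replace (e1 * B) with (eps / 2) by (unfold e1; field; lra).
      unfold e2. field. lra. }
  apply Rplus_le_compat; apply Rmult_le_compat; auto using Cmod_ge_0.
Qed.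

Lemma approx_uniform_limit (rho : R) (n : nat) (f : C -> C) :
  (forall eps, 0 < eps -> exists g, approx rho n g /\
     forall z, Cmod z <= rho -> Cmod (f z - g z) <= eps) -> approx rho n f.
Proof.
  intros H eps He. destruct (H (eps / 2) ltac:(lra)) as (g & Hg & Hfg).
  destruct (Hg (eps / 2) ltac:(lra)) as (N & u & Hu & Hgu).
  exists N, u. split; auto. intros z Hz. specialize (Hfg z Hz). specialize (Hgu z Hz).
  replace (f z - z ^ n * u z)%C with ((f z - g z) + (g z - z ^ n * u z))%C by ring.
  apply Rle_trans with (1 := Cmod_triangle _ _). lra.
Qed.

Lemma exists_pow_small (q eps : R) : 0 <= q < 1 -> 0 < eps -> exists N, q ^ N < eps.
Proof.
  intros Hq He. destruct (pow_lt_1_zero q ltac:(rewrite Rabs_right; lra) eps He) as [N HN].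
  exists N. specialize (HN N (Nat.le_refl N)). apply Rle_lt_trans with (2 := HN).
  apply Rle_abs.
Qed.

Lemma approx_geom (rho : R) (f : C -> C) (m : nat) :
  approx rho 0 f -> approx rho 0 (fun z => Csum (fun j => (f z ^ j)%C) m).
Proof.
  intros Hf. induction m as [|m IH]; simpl; [apply approx_const|].
  apply (approx_plus _ _ _ _ IH). clear IH.
  induction m as [|m IH]; simpl; [apply approx_const|now apply approx_mult].
Qed.

(** The partial sums of the geometric series in [1 - f] differ from [1 / f] by [(1 - f) ^ m / f],
    which is at most [q ^ m / (1 - q)] since [|f| >= 1 - q]. *)
Lemma approx_inv_near_1 (rho q : R) (f : C -> C) :
  0 <= q < 1 -> approx rho 0 f -> (forall z, Cmod z <= rho -> Cmod (1 - f z) <= q) ->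
  approx rho 0 (fun z => (/ f z)%C).
Proof.
  intros Hq Hf Hfq. apply approx_uniform_limit. intros eps He.
  destruct (exists_pow_small q (eps * (1 - q)) Hq ltac:(nra)) as [m Hm].
  assert (Hg : approx rho 0 (fun z => (1 + (- 1) * f z)%C)).
  { apply approx_plus; [apply approx_const|].
    apply approx_mult; [apply approx_const|exact Hf]. }
  exists (fun z => Csum (fun j => ((1 + (- 1) * f z) ^ j)%C) m).
  split; [now apply approx_geom|]. intros z Hz.
  specialize (Hfq z Hz).
  assert (Hfz : 1 - q <= Cmod (f z)).
  { assert (T := Cmod_le_sub 1 (f z)). rewrite Cmod_1 in T. lra. }
  assert (Hf0 : f z <> RtoC 0) by (apply Cmod_gt_0; lra).
  assert (G := Csum_geom (1 + (- 1) * f z) m).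
  set (s := Csum _ m) in *. set (x := (1 + (- 1) * f z)%C) in *.
  replace (/ f z - s)%C with (x ^ m / f z)%C.
  2:{ replace (x ^ m)%C with (1 + (x - 1) * s)%C by (rewrite G; ring).
      unfold x. field. exact Hf0. }
  rewrite Cmod_div, Cmod_pow by exact Hf0.
  apply Rle_div_l; [lra|].
  assert (Cmod x ^ m <= q ^ m).
  { apply Cmod_pow_le. unfold x. now replace (1 + (- 1) * f z)%C with (1 - f z)%C by ring. }
  nra.
Qed.

(* For [K] large, [f / K] lies in a disk of radius less than 1 around 1, where the
   geometric series for the inverse converges uniformly. *)
Lemma approx_inv (rho a : R) (f : C -> C) :
  0 < a -> approx rho 0 f -> (forall z, Cmod z <= rho -> a <= Re (f z)) ->
  approx rho 0 (fun z => (/ f z)%C).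
Proof.
  intros Ha Hf Hre. destruct (approx_bounded _ _ _ Hf) as (M0 & HM0 & HfM0).
  set (M := M0 + a).
  assert (HM : a < M) by (unfold M; lra).
  assert (HfM : forall z, Cmod z <= rho -> Cmod (f z) <= M)
    by (intros z Hz; specialize (HfM0 z Hz); unfold M; lra).
  (* With this [k], [|1 - k f|^2 = 1 - 2 k Re f + k^2 |f|^2 <= 1 - k a], because [Re f >= a] and
     [k |f|^2 <= a]. Taking [M > a] ensures [k * a < 1]. *)
  set (k := a / (M * M)).
  assert (HMM : 0 < M * M) by nra.
  assert (Hk : 0 < k) by (apply Rdiv_lt_0_compat; lra).
  assert (HkM : k * (M * M) = a) by (unfold k; field; lra).
  assert (Hka : 0 < k * a < 1).
  { split; [nra|]. assert (k * a < k * M) by nra. assert (k * M * M < 1 * M) by nra. nra. }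
  assert (Hkc : RtoC k <> RtoC 0) by (intros E; injection E; lra).
  apply approx_ext with (fun z => (k * / (k * f z))%C).
  { intros z Hz. specialize (Hre z Hz). field. split; [|exact Hkc].
    intros E; rewrite E in Hre; simpl in Hre; lra. }
  apply approx_mult; [apply approx_const|].
  apply approx_inv_near_1 with (sqrt (1 - k * a)).
  - split; [apply sqrt_pos|]. rewrite <- sqrt_1 at 2. apply sqrt_lt_1; lra.
  - apply approx_mult; [apply approx_const|exact Hf].
  - intros z Hz. specialize (Hre z Hz). specialize (HfM z Hz).
    assert (H2 := Cmod2_alt (f z)). assert (H0 := Cmod_ge_0 (f z)).
    assert (Hsq : Re (f z) ^ 2 + Im (f z) ^ 2 <= M * M).
    { rewrite <- H2. nra. }
    apply sqrt_le_1_alt. unfold Re, Im in *. simpl fst; simpl snd.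
    set (x := fst (f z)) in *. set (y := snd (f z)) in *.
    replace ((1 + - (k * x - 0 * y)) ^ 2 + (0 + - (k * y + 0 * x)) ^ 2)
      with (1 - 2 * (k * x) + k * (k * (x ^ 2 + y ^ 2))) by ring.
    assert (k * (x ^ 2 + y ^ 2) <= a) by nra.
    assert (k * (k * (x ^ 2 + y ^ 2)) <= k * a) by nra.
    assert (k * a <= k * x) by nra. lra.
Qed.

(** * Uniform convergence of power series on smaller disks *)

(** The index [N] is excluded, whereas [sum_n] includes its last index; hence the [S m] in the
    lemmas below. *)
Definition psum (a : nat -> C) (z : C) (N : nat) : C := Csum (fun k => (a k * z ^ k)%C) N.

Lemma sum_n_psum (a : nat -> C) (z : C) (m : nat) :
  sum_n (fun k => @scal C_Ring C_ModuleSpace (@pow_n C_Ring z k) (a k)) m = psum a z (S m).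
Proof.
  induction m as [|m IH].
  - rewrite sum_O. change (1 * a O = 0 + a O * 1)%C. ring.
  - rewrite sum_Sn, IH. unfold psum. simpl Csum.
    change (Csum (fun k => (a k * z ^ k)%C) m + a m * z ^ m + z ^ S m * a (S m)
            = Csum (fun k => (a k * z ^ k)%C) m + a m * z ^ m + a (S m) * z ^ S m)%C.
    ring.
Qed.

Lemma is_pseries_psum (a : nat -> C) (z l : C) :
  @is_pseries C_AbsRing C_NormedModule a z l ->
  forall eps, 0 < eps -> exists N, forall m, (N <= m)%nat -> Cmod (l - psum a z (S m)) < eps.
Proof.
  intros H eps He.
  destruct (proj1 (filterlim_locally_ball_norm _ _) H (mkposreal eps He)) as [N HN].
  exists N. intros m Hm. rewrite Cmod_sub_sym, <- sum_n_psum. exact (HN m Hm).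
Qed.

Lemma is_pseries_coeff_bounded (a : nat -> C) (z l : C) :
  @is_pseries C_AbsRing C_NormedModule a z l ->
  exists B, 0 <= B /\ forall k, Cmod (a k * z ^ k) <= B.
Proof.
  intros H.
  destruct (filterlim_bounded _ (ex_intro _ l H)) as [B HB].
  assert (HB' : forall m, Cmod (psum a z (S m)) <= B).
  { intros m. rewrite <- sum_n_psum. apply HB. }
  assert (HB0 : 0 <= B) by (apply Rle_trans with (2 := HB' O); apply Cmod_ge_0).
  assert (HB1 : forall m, Cmod (psum a z m) <= B).
  { intros [|m]; auto. unfold psum; simpl. rewrite Cmod_0. exact HB0. }
  exists (B + B). split; [lra|]. intros k.
  (* A term is the difference of two consecutive partial sums, and these are bounded by
     convergence. *)
  replace (a k * z ^ k)%C with (psum a z (S k) + - psum a z k)%C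
    by (unfold psum; simpl; ring).
  apply Rle_trans with (1 := Cmod_triangle _ _). rewrite Cmod_opp.
  apply Rplus_le_compat; auto.
Qed.

(** The geometric tail is kept in exact closed form, so that the induction on [m] closes. *)
Lemma psum_tail_le (a : nat -> C) (z : C) (B q : R) :
  0 <= q < 1 -> (forall k, Cmod (a k * z ^ k) <= B * q ^ k) ->
  forall N m, Cmod (psum a z (N + m) - psum a z N) <= B * (q ^ N - q ^ (N + m)) / (1 - q).
Proof.
  intros Hq H N m. apply Rle_div_r; [lra|]. induction m as [|m IH].
  - rewrite Nat.add_0_r. unfold Cminus. rewrite Cplus_opp_r, Cmod_0. lra.
  - rewrite Nat.add_succ_r. unfold psum in *. simpl Csum.
    set (s := Csum _ (N + m)) in *. set (t := Csum _ N) in *. specialize (H (N + m)%nat).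
    set (u := (a (N + m)%nat * z ^ (N + m))%C) in *.
    replace (s + u - t)%C with ((s - t) + u)%C by ring.
    assert (T := Cmod_triangle (s - t) u). simpl. nra.
Qed.

(** Convergence at an intermediate radius [s] bounds the coefficients, so on the smaller disk the
    terms are dominated by [B * (rho / s) ^ k], independently of [z]. *)
Lemma pseries_psum_uniform (a : nat -> C) (p : C -> C) (rho : R) :
  0 < rho < 1 ->
  (forall z, Cmod z < 1 -> @is_pseries C_AbsRing C_NormedModule a z (p z)) ->
  forall eps, 0 < eps -> exists N,
  forall z, Cmod z <= rho -> Cmod (p z - psum a z (S N)) <= eps.
Proof.
  intros Hr Hp eps He. set (s := (1 + rho) / 2).
  assert (Hs : 0 < s < 1 /\ rho < s) by (unfold s; lra).
  assert (Hsm : Cmod s = s) by (rewrite Cmod_R, Rabs_right; lra).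
  destruct (is_pseries_coeff_bounded a s (p s) (Hp s ltac:(lra))) as (B & HB0 & HB).
  set (q := rho / s).
  assert (Hq : 0 <= q < 1).
  { split; [apply Rlt_le, Rdiv_lt_0_compat; lra|apply Rlt_div_l; lra]. }
  assert (Hterm : forall z, Cmod z <= rho -> forall k, Cmod (a k * z ^ k) <= B * q ^ k).
  { intros z Hz k. specialize (HB k). rewrite Cmod_mult, Cmod_pow, Hsm in HB.
    rewrite Cmod_mult, Cmod_pow.
    assert (Hzk := Cmod_pow_le z rho k Hz).
    replace rho with (s * q) in Hzk by (unfold q; field; lra).
    rewrite Rpow_mult_distr in Hzk.
    assert (0 <= q ^ k) by (apply pow_le; lra).
    assert (Ha := Cmod_ge_0 (a k)). nra. }
  (* Dividing by [B + 1] covers the case [B = 0]. *)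
  destruct (exists_pow_small q (eps * (1 - q) / (B + 1)) Hq) as [N HN].
  { apply Rdiv_lt_0_compat; nra. }
  apply Rlt_div_r in HN; [|lra].
  (* [N] is fixed before [z]. Pointwise convergence, with an index [N1] depending on [z], only
     serves to let the finite tail estimate reach the limit, up to [d]. *)
  exists N. intros z Hz. apply le_epsilon. intros d Hd.
  destruct (is_pseries_psum a z (p z) (Hp z ltac:(lra)) d Hd) as [N1 HN1].
  specialize (HN1 (N + N1)%nat ltac:(lia)).
  assert (HT := psum_tail_le a z B q Hq (Hterm z Hz) (S N) N1).
  replace (p z - psum a z (S N))%C
    with ((p z - psum a z (S (N + N1))) + (psum a z (S (N + N1)) - psum a z (S N)))%C by ring.
  apply Rle_trans with (1 := Cmod_triangle _ _). simpl Nat.add in HT.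
  assert (B * (q ^ S N - q ^ S (N + N1)) / (1 - q) <= eps); [|lra].
  apply Rle_div_l; [lra|].
  assert (0 <= q ^ S (N + N1)) by (apply pow_le; lra).
  assert (0 <= q ^ N) by (apply pow_le; lra).
  assert (q ^ S N <= q ^ N) by (simpl; nra). nra.
Qed.

(** Indices below [n] leave the cofactor unchanged, and each index [k >= n] adds the monomial
    [a k * z ^ (k - n)]. The case [n = 0] is included and is used to approximate [p] itself. *)
Lemma psum_factor (a : nat -> C) (n N : nat) :
  (forall k, (0 < k < n)%nat -> a k = RtoC 0) ->
  exists g, poly_lt (S N) g /\ forall z, (psum a z (S N) - a O = z ^ n * g z)%C.
Proof.
  intros Ha. induction N as [|N (g & Hg & E)].
  - exists (fun z => (0 * z ^ 0)%C). split; [apply poly_mono; lia|].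
    intros z. unfold psum; simpl. ring.
  - destruct (Nat.lt_ge_cases (S N) n) as [Hn|Hn].
    + exists g. split; [apply poly_lt_weaken with (2 := Hg); lia|].
      intros z. rewrite <- E. unfold psum. simpl Csum. rewrite (Ha (S N)) by lia. ring.
    + exists (fun z => (g z + a (S N) * z ^ (S N - n))%C). split.
      * apply poly_plus; [apply poly_lt_weaken with (2 := Hg)|apply poly_mono]; lia.
      * intros z. rewrite Cmult_plus_distr_l, <- E.
        replace (z ^ n * (a (S N) * z ^ (S N - n)))%C
          with (a (S N) * (z ^ n * z ^ (S N - n)))%C by ring.
        rewrite <- Cpow_add_r. replace (n + (S N - n))%nat with (S N) by lia.
        change (psum a z (S (S N))) with (psum a z (S N) + a (S N) * z ^ S N)%C.
        set (u := (z ^ S N)%C). ring.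
Qed.

Lemma approx_pseries (a : nat -> C) (p : C -> C) (rho : R) (n : nat) :
  0 < rho < 1 -> (forall k, (0 < k < n)%nat -> a k = RtoC 0) ->
  (forall z, Cmod z < 1 -> @is_pseries C_AbsRing C_NormedModule a z (p z)) ->
  approx rho n (fun z => (p z - a O)%C).
Proof.
  intros Hr Ha Hp eps He.
  destruct (pseries_psum_uniform a p rho Hr Hp eps He) as [N HN].
  destruct (psum_factor a n N Ha) as (g & Hg & E).
  exists (S N), g. split; auto. intros z Hz. rewrite <- E.
  replace (p z - a O - (psum a z (S N) - a O))%C with (p z - psum a z (S N))%C by ring.
  auto.
Qed.

(** * The Schwarz bound *)

Lemma le_of_left_continuous (f : R -> R) (r s Y : R) :
  s < r -> continuity_pt f r -> (forall x, s < x < r -> f x <= Y) -> f r <= Y.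
Proof.
  intros Hs Hc H. apply le_epsilon. intros e He.
  destruct (Hc e He) as (d & Hd & Hx).
  set (h := Rmin d (r - s) / 2).
  assert (0 < h /\ h < d /\ h < r - s).
  { unfold h. assert (0 < Rmin d (r - s)) by (apply Rmin_pos; lra).
    assert (Rmin d (r - s) <= d) by apply Rmin_l.
    assert (Rmin d (r - s) <= r - s) by apply Rmin_r. lra. }
  specialize (Hx (r - h)). specialize (H (r - h) ltac:(lra)).
  simpl in Hx. unfold Rdist in Hx.
  assert (Habs : Rabs (f (r - h) - f r) < e).
  { apply Hx. split.
    - unfold D_x, no_cond. split; [auto|lra].
    - replace (r - h - r) with (- h) by ring. rewrite Rabs_Ropp, Rabs_right; lra. }
  apply Rabs_def2 in Habs. lra.
Qed.

(* Schwarz' lemma for [(p - a0) / (p + a0)], which has a zero of order [n] at 0. *)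
Lemma positive_real_part_schwarz (n : nat) (a0 r : R) (p : C -> C) (a : nat -> C) :
  0 < a0 -> r < 1 -> a O = RtoC a0 ->
  (forall k, (0 < k < n)%nat -> a k = RtoC 0) ->
  (forall z, Cmod z < 1 -> @is_pseries C_AbsRing C_NormedModule a z (p z)) ->
  (forall z, Cmod z < r -> 0 < Re (p z)) ->
  forall z, Cmod z < r -> r ^ n * Cmod (p z - a0) <= Cmod z ^ n * Cmod (p z + a0).
Proof.
  intros Ha0 Hr Ea Ha Hp Hre z Hz. assert (Hz0 := Cmod_ge_0 z).
  (* Positivity of [Re p] is known only inside the open disk of radius [r], so the bound is proved
     for each [rho] between [Cmod z] and [r], and then [rho] tends to [r]. *)
  apply (le_of_left_continuous (fun rho => rho ^ n * Cmod (p z - a0)) r (Cmod z)); auto.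
  { apply derivable_continuous_pt, ex_derive_Reals_0. auto_derive; auto. }
  intros rho Hrho.
  assert (Hpos : forall y, Cmod y <= rho -> 0 < Re (p y)) by (intros; apply Hre; lra).
  assert (Hpa : forall y, Cmod y <= rho -> 0 < Cmod (p y + a0)).
  { intros y Hy. apply Cmod_gt_0. intros E. specialize (Hpos y Hy).
    assert (E' := f_equal Re E). simpl in E'. unfold Re in Hpos. lra. }
  set (w := fun y => ((p y - a0) * / (p y + a0))%C).
  assert (Hw : approx rho n w).
  { unfold w. apply approx_mult.
    - rewrite <- Ea. apply approx_pseries; auto; lra.
    - apply approx_inv with a0; auto.
      + apply approx_ext with (fun y => ((p y - a O) + (a0 + a0))%C).
        { intros y _. rewrite Ea. ring. }
        apply approx_plus; [|apply approx_const].
        apply approx_pseries; auto; [lra|]. intros; lia.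
      + intros y Hy. specialize (Hpos y Hy). simpl. unfold Re in Hpos. lra. }
  (* For [Re (p y) > 0] the point [p y] is closer to [a0] than to [- a0]. *)
  assert (Hw1 : forall y, Cmod y = rho -> Cmod (w y) <= 1).
  { intros y Hy. specialize (Hpos y ltac:(lra)). specialize (Hpa y ltac:(lra)).
    unfold w. rewrite Cmod_mult, Cmod_inv by now apply Cmod_gt_0.
    apply Rle_div_l; [assumption|]. rewrite Rmult_1_l.
    apply sqrt_le_1_alt. simpl fst; simpl snd. unfold Re in Hpos. nra. }
  assert (Hmax := approx_max_modulus rho 1 n w ltac:(lra) Hw Hw1 z ltac:(lra)).
  specialize (Hpa z ltac:(lra)).
  replace (p z - a0)%C with (w z * (p z + a0))%C.
  2:{ unfold w. field. now apply Cmod_gt_0. }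
  rewrite Cmod_mult. nra.
Qed.

(** * One-sided derivative estimates at the boundary point *)

(** [L] stands for [Re] or [Im]: real homogeneity and subtractivity carry the difference quotient
    over to [L], and the bound by [Cmod] controls the remainder. *)
Lemma is_derive_along_line (L : C -> R) (f : C -> C) (z d v : C) :
  (forall x y, L (x - y)%C = L x - L y) ->
  (forall (t : R) x, L (t * x)%C = t * L x) ->
  (forall x, Rabs (L x) <= Cmod x) ->
  @is_derive C_AbsRing C_NormedModule f z d ->
  is_derive (fun t : R => L (f (z + t * v)%C)) 0 (L (v * d)%C).
Proof.
  intros HLm HLs HLb [_ Hd].
  specialize (Hd z (fun P HP => HP)).
  apply is_derive_Reals. intros eps He.
  assert (Hv := Cmod_ge_0 v).
  (* The [+ 1] admits [v = 0] and makes the final inequality strict. *)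
  assert (He' : 0 < eps / (Cmod v + 1)) by (apply Rdiv_lt_0_compat; lra).
  destruct (Hd (mkposreal _ He')) as [del Hdel]. simpl in Hdel.
  assert (Hdel' : 0 < del / (Cmod v + 1)) by (apply Rdiv_lt_0_compat; [apply cond_pos|lra]).
  exists (mkposreal _ Hdel'). intros h Hh0 Hh. simpl in Hh.
  rewrite Rplus_0_l. replace (z + 0 * v)%C with z by ring.
  assert (Hhv : Rabs h * (Cmod v + 1) < del) by (apply Rlt_div_r; lra).
  assert (Hh' := Rabs_pos_lt h Hh0).
  assert (B := Hdel (z + h * v)%C).
  assert (Hmin : (z + h * v - z)%C = (h * v)%C) by ring.
  assert (Bb : ball (M := AbsRing_UniformSpace C_AbsRing) z del (z + h * v)%C).
  { change (Cmod (z + h * v - z) < del). rewrite Hmin, Cmod_mult, Cmod_R. nra. }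
  specialize (B Bb).
  change (Cmod (f (z + h * v)%C - f z - (z + h * v - z) * d)
          <= eps / (Cmod v + 1) * Cmod (z + h * v - z)) in B.
  rewrite Hmin, (Cmod_mult h), Cmod_R in B.
  set (rem := (f (z + h * v)%C - f z - h * v * d)%C) in *.
  replace ((L (f (z + h * v)%C) - L (f z)) / h - L (v * d)%C) with (L rem / h).
  2:{ unfold rem. rewrite !HLm. replace (h * v * d)%C with (h * (v * d))%C by ring.
      rewrite HLs. field. exact Hh0. }
  unfold Rdiv. rewrite Rabs_mult, Rabs_inv. apply Rlt_div_l; [assumption|].
  apply Rle_lt_trans with (1 := HLb _), Rle_lt_trans with (1 := B).
  replace (eps * Rabs h) with (eps / (Cmod v + 1) * (Rabs h * (Cmod v + 1))) by (field; lra).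
  apply Rmult_lt_compat_l; [assumption|]. nra.
Qed.

Lemma is_derive_Re_along_line (f : C -> C) (z d v : C) :
  @is_derive C_AbsRing C_NormedModule f z d ->
  is_derive (fun t : R => Re (f (z + t * v)%C)) 0 (Re (v * d)%C).
Proof.
  apply is_derive_along_line.
  - reflexivity.
  - intros t x. simpl. unfold Re. ring.
  - apply re_le_Cmod.
Qed.

Lemma is_derive_Im_along_line (f : C -> C) (z d v : C) :
  @is_derive C_AbsRing C_NormedModule f z d ->
  is_derive (fun t : R => Im (f (z + t * v)%C)) 0 (Im (v * d)%C).
Proof.
  apply is_derive_along_line.
  - reflexivity.
  - intros t x. simpl. unfold Im. ring.
  - intros x. apply Rle_trans with (2 := Rmax_Cmod x). apply Rmax_r.
Qed.

Lemma is_derive_ge_0_at_right (g : R -> R) (l e : R) :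
  is_derive g 0 l -> g 0 = 0 -> 0 < e -> (forall t, 0 < t < e -> 0 <= g t) -> 0 <= l.
Proof.
  intros Hg Hg0 He H. apply is_derive_Reals in Hg.
  apply le_epsilon. intros eps Heps. destruct (Hg eps Heps) as [del Hdel].
  set (h := Rmin del e / 2).
  assert (0 < h /\ h < del /\ h < e).
  { unfold h. assert (Hd := cond_pos del). assert (0 < Rmin del e) by (apply Rmin_pos; lra).
    assert (Rmin del e <= del) by apply Rmin_l.
    assert (Rmin del e <= e) by apply Rmin_r. lra. }
  specialize (Hdel h ltac:(lra) ltac:(rewrite Rabs_right; lra)).
  rewrite Rplus_0_l, Hg0, Rminus_0_r in Hdel. apply Rabs_def2 in Hdel.
  assert (0 <= g h / h) by (apply Rdiv_le_0_compat; [apply H|]; lra). lra.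
Qed.

Lemma Cmod_lt_of_sq (x y : C) :
  Re x ^ 2 + Im x ^ 2 < Re y ^ 2 + Im y ^ 2 -> Cmod x < Cmod y.
Proof.
  intros H. apply sqrt_lt_1_alt. unfold Re, Im in H. split; [|exact H]. nra.
Qed.

(* [z0 + t z0 v] enters the disk [|z| < |z0|] as soon as [Re v < 0]. *)
Lemma inward_derivative_ge_0 (p : C -> C) (z0 d v : C) :
  @is_derive C_AbsRing C_NormedModule p z0 d -> z0 <> RtoC 0 ->
  (forall z, Cmod z < Cmod z0 -> 0 < Re (p z)) -> Re (p z0) = 0 -> Re v < 0 ->
  0 <= Re (v * (z0 * d))%C.
Proof.
  intros Hd Hz0 Hre H0 Hv.
  assert (Hm : 0 < Cmod z0) by now apply Cmod_gt_0.
  set (q := Re v ^ 2 + Im v ^ 2). assert (Hq : 0 < q) by (unfold q; nra).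
  assert (D := is_derive_Re_along_line p z0 d (z0 * v) Hd).
  replace (v * (z0 * d))%C with (z0 * v * d)%C by ring.
  (* [|1 + t v|^2 = 1 + 2 t Re v + t^2 |v|^2] stays below 1 exactly for
     [0 < t < - 2 Re v / |v|^2]. *)
  apply (is_derive_ge_0_at_right _ _ (- 2 * Re v / q) D).
  - replace (z0 + 0 * (z0 * v))%C with z0 by ring. exact H0.
  - apply Rdiv_lt_0_compat; lra.
  - intros t Ht. apply Rlt_le, Hre.
    replace (z0 + t * (z0 * v))%C with (z0 * (1 + t * v))%C by ring.
    rewrite Cmod_mult. rewrite <- (Rmult_1_r (Cmod z0)) at 2.
    apply Rmult_lt_compat_l; [assumption|].
    apply Rlt_le_trans with (Cmod 1); [|rewrite Cmod_1; lra].
    apply Cmod_lt_of_sq. unfold q, Re, Im in *; simpl fst in *; simpl snd in *.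
    set (x := fst v) in *. set (y := snd v) in *.
    assert (t * (x ^ 2 + y ^ 2) < - 2 * x) by (apply Rlt_div_r; lra).
    assert (0 < t * (- 2 * x - t * (x ^ 2 + y ^ 2))) by (apply Rmult_lt_0_compat; lra).
    nra.
Qed.

(** Inward directions [v = - e + i s] may be taken almost tangential: as [e] tends to 0 the
    inequality becomes [s * B <= 0] for every real [s], which forces [B = 0]. *)
Lemma boundary_derivative_real (p : C -> C) (z0 d : C) :
  @is_derive C_AbsRing C_NormedModule p z0 d -> z0 <> RtoC 0 ->
  (forall z, Cmod z < Cmod z0 -> 0 < Re (p z)) -> Re (p z0) = 0 ->
  Im (z0 * d)%C = 0.
Proof.
  intros Hd Hz0 Hre H0.
  assert (key : forall e s, 0 < e -> 0 <= - e * Re (z0 * d)%C - s * Im (z0 * d)%C).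
  { intros e s He. apply (inward_derivative_ge_0 p z0 d (- e, s) Hd Hz0 Hre H0).
    simpl. lra. }
  set (A := Re (z0 * d)%C) in *. set (B := Im (z0 * d)%C) in *.
  assert (bound : forall s, s * B <= 0).
  { intros s. apply le_of_le_mult_eps with (1 + Rabs A); [assert (H := Rabs_pos A); lra|].
    intros e He. specialize (key e s He).
    assert (H1 := Rle_abs (- A)). rewrite Rabs_Ropp in H1. nra. }
  assert (H1 := bound 1). assert (H2 := bound (-1)). lra.
Qed.

(** Along the radius [(1 - t) z0], the squared Schwarz bound reads [g t >= 0] with [g 0 = 0], so [g]
    has nonnegative derivative at 0. Squaring makes [g] polynomial in [x], [y] and [t], and the
    terms with the derivative of [y] cancel at [t = 0]. *)
Lemma boundary_derivative_le (p : C -> C) (z0 d : C) (n : nat) (a0 beta : R) :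
  @is_derive C_AbsRing C_NormedModule p z0 d -> 0 < a0 -> z0 <> RtoC 0 ->
  p z0 = (RtoC beta * Ci)%C ->
  (forall z, Cmod z < Cmod z0 ->
     Cmod z0 ^ n * Cmod (p z - a0) <= Cmod z ^ n * Cmod (p z + a0)) ->
  2 * a0 * Re (z0 * d)%C <= - (INR n * (a0 ^ 2 + beta ^ 2)).
Proof.
  intros Hd Ha0 Hz0 Hp H.
  assert (Hm : 0 < Cmod z0) by now apply Cmod_gt_0.
  assert (Dx := is_derive_Re_along_line p z0 d (- z0) Hd).
  assert (Dy := is_derive_Im_along_line p z0 d (- z0) Hd).
  set (x := fun t : R => Re (p (z0 + t * - z0)%C)) in *.
  set (y := fun t : R => Im (p (z0 + t * - z0)%C)) in *.
  assert (Ez : (z0 + 0 * - z0)%C = z0) by ring.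
  assert (Ex : x 0 = 0) by (unfold x; rewrite Ez, Hp; simpl; ring).
  assert (Ey : y 0 = beta) by (unfold y; rewrite Ez, Hp; simpl; ring).
  replace (Re (- z0 * d)%C) with (- Re (z0 * d)%C) in Dx by (unfold Re; simpl; ring).
  set (A := Re (z0 * d)%C) in *. set (B := Im (- z0 * d)%C) in *.
  pose (g := fun t : R => ((1 - t) ^ n) ^ 2 * ((x t + a0) ^ 2 + y t ^ 2)
                          - ((x t - a0) ^ 2 + y t ^ 2)).
  assert (Dg : is_derive g 0 (- 2 * INR n * (a0 ^ 2 + beta ^ 2) - 4 * a0 * A)).
  { assert (ex_derive x 0) by (eexists; exact Dx).
    assert (ex_derive y 0) by (eexists; exact Dy).
    unfold g. auto_derive; [repeat split; auto|].
    change (fun x0 : R => x x0) with x. change (fun x0 : R => y x0) with y.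
    rewrite (is_derive_unique _ _ _ Dx), (is_derive_unique _ _ _ Dy), Ex, Ey.
    replace (1 + - 0) with 1 by ring. rewrite !pow1. ring. }
  assert (0 <= - 2 * INR n * (a0 ^ 2 + beta ^ 2) - 4 * a0 * A); [|lra].
  apply (is_derive_ge_0_at_right g _ 1 Dg); [|lra|].
  - unfold g. rewrite Ex, Ey, Rminus_0_r, pow1. ring.
  - intros t Ht. unfold g, x, y. set (z := (z0 + t * - z0)%C).
    assert (Ezm : Cmod z = (1 - t) * Cmod z0).
    { unfold z. replace (z0 + t * - z0)%C with ((1 - t) * z0)%C by ring.
      rewrite Cmod_mult, <- RtoC_minus, Cmod_R, Rabs_right; lra. }
    specialize (H z ltac:(rewrite Ezm; nra)).
    rewrite Ezm, Rpow_mult_distr in H.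
    assert (Hmn : 0 < Cmod z0 ^ n) by now apply pow_lt.
    assert (Htn : 0 < (1 - t) ^ n) by (apply pow_lt; lra).
    assert (H' : Cmod (p z - a0) <= (1 - t) ^ n * Cmod (p z + a0)).
    { apply Rmult_le_reg_l with (Cmod z0 ^ n); [assumption|]. lra. }
    assert (Sm := Cmod2_alt (p z - a0)). assert (Sp := Cmod2_alt (p z + a0)).
    assert (E1 : Re (p z - a0)%C = Re (p z) - a0) by reflexivity.
    assert (E2 : Re (p z + a0)%C = Re (p z) + a0) by reflexivity.
    assert (E3 : Im (p z - a0)%C = Im (p z)) by (unfold Im; simpl; ring).
    assert (E4 : Im (p z + a0)%C = Im (p z)) by (unfold Im; simpl; ring).
    rewrite E1, E3 in Sm. rewrite E2, E4 in Sp.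
    rewrite <- Sm, <- Sp, <- Rpow_mult_distr.
    assert (Hpow := pow_incr _ _ 2 (conj (Cmod_ge_0 _) H')). lra.
Qed.

Theorem theorem1 (n : nat) (hn : (0 < n)%nat) (a0 : R) (ha0 : 0 < a0)
  (p : C -> C) (hp : class_H (RtoC a0) n p)
  (z0 : C) (hz0 : unit_disk z0)
  (hre : forall z : C, Cmod z < Cmod z0 -> 0 < Re (p z))
  (beta : R) (hbeta : beta <> 0) (hpz0 : p z0 = (RtoC beta * Ci)%C) :
  exists l : R,
    (z0 * C_derive p z0 / p z0 = Ci * RtoC l)%C /\
    (0 < beta ->
       l >= INR n / 2 * (a0 / beta + beta / a0) /\
       INR n / 2 * (a0 / beta + beta / a0) >= INR n) /\
    (beta < 0 ->
       l <= INR n / 2 * (a0 / beta + beta / a0) /\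
       INR n / 2 * (a0 / beta + beta / a0) <= - INR n).
Proof.
  destruct hp as [han (a & Ea & Ha & Hp)]. unfold unit_disk in *.
  assert (hd := C_derive_correct p z0 z0 (han z0 hz0)).
  set (d := C_derive p z0) in *.
  (* At the origin [p] takes the value [a0], which has positive real part, unlike [p z0]. *)
  assert (Hz0 : z0 <> RtoC 0).
  { intros E.
    assert (E0 : p 0 = RtoC a0).
    { assert (H0 := Hp 0 ltac:(rewrite Cmod_0; lra)). apply Ceq_minus, Cmod_eq_0.
      apply Rle_antisym; [|apply Cmod_ge_0]. apply le_epsilon. intros e He.
      destruct (is_pseries_psum a 0 (p 0) H0 e He) as [N HN].
      specialize (HN N (Nat.le_refl N)).
      replace (psum a 0 (S N)) with (RtoC a0) in HN; [lra|].
      symmetry. unfold psum. rewrite Csum_single with (k := O); [|lia|].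
      - rewrite Ea. simpl. ring.
      - intros [|j] _ Hj; [lia|]. rewrite Cpow_S. ring. }
    rewrite E, E0 in hpz0. assert (E1 := f_equal Re hpz0). simpl in E1. lra. }
  assert (HReal := boundary_derivative_real p z0 d hd Hz0 hre
                     ltac:(rewrite hpz0; simpl; ring)).
  assert (HA := boundary_derivative_le p z0 d n a0 beta hd ha0 Hz0 hpz0
    (positive_real_part_schwarz n a0 (Cmod z0) p a ha0 hz0 Ea Ha Hp hre)).
  set (A := Re (z0 * d)%C) in *.
  assert (ED : (z0 * d)%C = RtoC A).
  { rewrite (surjective_pairing (z0 * d)%C). unfold Im in HReal. rewrite HReal. reflexivity. }
  assert (Hn : 0 < INR n) by now apply lt_0_INR.
  assert (Hmid : forall b, 0 < b -> INR n / 2 * (a0 / b + b / a0)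
            = INR n * (a0 ^ 2 + b ^ 2) / (2 * a0 * b)).
  { intros b Hb. field. lra. }
  (* Stated for a positive [b] with [b ^ 2 = beta ^ 2], to serve both signs through [b = beta] and
     [b = - beta]. The lower bound [n] is the inequality [(a0 - b) ^ 2 >= 0]. *)
  assert (Hge : forall b, 0 < b -> b ^ 2 = beta ^ 2 ->
            INR n * (a0 ^ 2 + b ^ 2) / (2 * a0 * b) <= - A / b /\
            INR n <= INR n * (a0 ^ 2 + b ^ 2) / (2 * a0 * b)).
  { intros b Hb Eb. assert (0 < a0 * b) by nra. split.
    - apply Rle_div_l; [lra|].
      replace (- A / b * (2 * a0 * b)) with (- (2 * a0 * A)) by (field; lra).
      rewrite Eb. lra.
    - apply Rle_div_r; [lra|]. assert (0 <= (a0 - b) ^ 2) by apply pow2_ge_0. nra. }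
  exists (- A / beta). split; [|split].
  - rewrite ED, hpz0. unfold Rdiv. rewrite RtoC_mult, RtoC_opp, RtoC_inv by assumption.
    assert (Hb : RtoC beta <> RtoC 0) by (intros E; injection E; lra).
    assert (HCi : (Ci * Ci = - (1))%C).
    { unfold Cmult, Copp, Ci, RtoC; simpl. f_equal; ring. }
    (* [field] treats [Ci] as an atom, so the factor 1 is inserted in the form [- (Ci * Ci)] to move
       [Ci] out of the denominator. *)
    transitivity (- (Ci * Ci) * (A / (beta * Ci)))%C.
    + rewrite HCi. field. repeat split; first [exact Hb | apply Ci_nz].
    + field. repeat split; first [exact Hb | apply Ci_nz].
  - intros Hb. destruct (Hge beta Hb eq_refl). rewrite Hmid by exact Hb. lra.
  - intros Hb. destruct (Hge (- beta) ltac:(lra) ltac:(ring)) as [H1 H2].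
    rewrite <- Hmid in H1, H2 by lra.
    replace (a0 / - beta + - beta / a0) with (- (a0 / beta + beta / a0)) in H1, H2
      by (field; lra).
    replace (- A / - beta) with (- (- A / beta)) in H1 by (field; lra). lra.
Qed.
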